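(* Let $d\ge 2$ and let $p=(p_1,\dots,p_d)\in[0,1]^d$ be a vector of splitting probabilities (a probability vector). Let $s_n$ be the number of successes of the $d$-ary tree algorithm with successive interference cancellation (SICTA) with splitting probabilities $p$, started with $n$ packets, let $S_n=\mathbb{E}[s_n]$ be the expected number of successes, and put $\overline{F}(k)=\sum_{j=k+1}^d p_j$. Then $$S_n=1+\sum_{i=2}^n\binom{n}{i}\frac{(-1)^{i-1}\,i\,\Big(1-\sum_{k=1}^{d}p_{k}\overline{F}(k-1)^{i-1}\Big)}{1-\sum_{j=1}^d p_j^i},$$ and the exponential moment generating function $\widetilde{S}(x,z)=\sum_{n\ge 0}\frac{x^n}{n!}\mathbb{E}[z^{s_n}]$ satisfies $$\widetilde{S}(x,z)=(1-p_1)x(z-1)+\prod_{i=1}^{d}\widetilde{S}(xp_i,z)+\sum_{k=1}^{d-1} xp_{k+1}(1-z)\prod_{i=1}^{k}\widetilde{S}(xp_i,z).$$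
   Context: Definition of $s_n$. For $n\ge 2$ let $(I_1,\dots,I_d)$ be multinomially distributed with $n$ trials and cell probabilities $p$ ($I_j$ is the number of the $n$ users choosing slot $j$), and let $$M=\inf\Big\{k\in\{1,\dots,d\}:\ \sum_{j=1}^k I_j\ge n-1\Big\}.$$ The random variables $s_n$ are defined recursively by $s_0=0$, $s_1=1$ and, for $n\ge 2$, $$s_n=\sum_{j=1}^{M} s_{I_j},$$ where, given $(I_1,\dots,I_d)$, the variables $s_{I_1},\dots,s_{I_d}$ on the right are independent, $s_{I_j}$ having the law of $s_m$ with $m=I_j$.
   Formalization: The leading constant 1 in the formula for S_n is replaced by n (as printed it gives S_0=1 and S_2=0, whereas s_0=0 and s_2=1 a.s.), and the formula is stated only when all p_j<1, since otherwise its denominators vanish and the recursion leaves s_n undetermined. *)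

(* Defs.v *)
From mathcomp Require Import all_boot all_order all_algebra.
From mathcomp Require Import all_classical all_reals all_analysis.

Set Implicit Arguments.
Unset Strict Implicit.
Unset Printing Implicit Defensive.

Import Order.TTheory GRing.Theory Num.Theory.
Import numFieldNormedType.Exports.

Local Open Scope classical_set_scope.
Local Open Scope ring_scope.

(* Slots are numbered from 0: the slots 1, ..., d of the mathematical text are
   the elements 0, ..., d - 1 of 'I_d.  Thus "the first k slots" is
   [j : 'I_d | j < k]. *)

Definition prob_vector (R : realType) (d : nat) (p : 'I_d -> R) : Prop :=
  (forall j, 0 <= p j <= 1) /\ \sum_(j < d) p j = 1.

Definition multinomial_pmf (R : realType) (d : nat) (p : 'I_d -> R) (n : nat)
    (i : 'I_d -> nat) : R :=
  if (\sum_(j < d) i j == n)%N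
  then n`!%:R / (\prod_(j < d) (i j)`!%:R) * \prod_(j < d) p j ^+ i j
  else 0.

(* The infimum of the k in {1, ..., d} such that the first k slots hold at
   least n - 1 packets.  The unit d of the iterated minimum is harmless: when
   the i_j sum to n, k = d always qualifies. *)
Definition stop_slot (d n : nat) (i : 'I_d -> nat) : nat :=
  (\big[minn/d]_(1 <= k < d.+1 | (n - 1 <= \sum_(j < d | j < k) i j)%N) k)%N.

(* The distributional recursion for s_n, n >= 2: on some probability space
   (T', Q) there are slot counts I_j and variables X_j (in the role of s_{I_j})
   such that I is multinomial; given I = i, the X_j are independent, X_j having
   the law of s_{i_j}; and s_n has the law of X_1 + ... + X_M. *)
Definition sicta_step (R : realType) (dT : measure_display)
    (T : measurableType dT) (P : probability T R) (d : nat) (p : 'I_d -> R)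
    (s : nat -> {RV P >-> nat}) (n : nat) : Prop :=
  exists (dT' : measure_display) (T' : measurableType dT')
         (Q : probability T' R) (I X : 'I_d -> {RV Q >-> nat}),
    [/\ forall i : 'I_d -> nat,
          Q [set t | forall j, I j t = i j] = (multinomial_pmf p n i)%:E,
        forall i x : 'I_d -> nat,
          Q [set t | (forall j, I j t = i j) /\ (forall j, X j t = x j)] =
          (Q [set t | forall j, I j t = i j] *
           \prod_(j < d) P [set t | s (i j) t = x j])%E
      & forall m : nat,
          P [set t | s n t = m] =
          Q [set t | (\sum_(j < d | j < stop_slot n (fun l => I l t)) X j t)%N
                     = m] ].

(* When some p_j equals 1, sicta_step reduces to "s_n has the law of s_n": all packets
   collide forever and the recursion leaves s_n (n >= 2) undetermined.  When
   all p_j < 1 it determines the law of every s_n. *)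
Definition sicta_successes (R : realType) (dT : measure_display)
    (T : measurableType dT) (P : probability T R) (d : nat) (p : 'I_d -> R)
    (s : nat -> {RV P >-> nat}) : Prop :=
  [/\ P [set t | s 0%N t = 0%N] = 1%E,
      P [set t | s 1%N t = 1%N] = 1%E
    & forall n, (2 <= n)%N -> sicta_step p s n].

(* Fbar p k = p_{k+1} + ... + p_d in the 1-based numbering. *)
Definition Fbar (R : realType) (d : nat) (p : 'I_d -> R) (k : nat) : R :=
  \sum_(j < d | (k <= j)%N) p j.

Definition egf_term (R : realType) (dT : measure_display)
    (T : measurableType dT) (P : probability T R) (s : nat -> {RV P >-> nat})
    (x z : R) (n : nat) : R :=
  x ^+ n / n`!%:R * fine 'E_P[fun t => z ^+ s n t].

Definition egf (R : realType) (dT : measure_display)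
    (T : measurableType dT) (P : probability T R) (s : nat -> {RV P >-> nat})
    (x z : R) : R :=
  limn (series (egf_term s x z)).

(* Main.v *)
Require Import Defs.
From mathcomp Require Import all_boot all_order all_algebra.
From mathcomp Require Import all_classical all_reals all_analysis.
From mathcomp Require Import zify ring lra.
From mathcomp Require Import measurable_realfun.

Set Implicit Arguments.
Unset Strict Implicit.
Unset Printing Implicit Defensive.

Import Order.TTheory GRing.Theory Num.Theory.
Import numFieldNormedType.Exports.

Local Open Scope classical_set_scope.
Local Open Scope ring_scope.

(** Conditioning on the slot counts turns the definition of s_n into a recursion
    for its law, in which only the slots read before the stopping time count.
    The key remark is that at most one packet is then left unread, and that such
    a packet is alone in its slot ([stop_slot_split]).  Hence the product of the
    generating functions over the slots that were read is the product over all
    the slots, plus a factor 1 - z times the product over the slots before l, for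
    the configurations where the last packet is alone in slot l and all the
    others precede it ([prod_stop_slot]).

    Multinomial weights are exactly what the product of d exponential generating
    functions produces ([pmf_convolution]), so the first part gives the product
    of the S(x p_i) and the second one gives x p_l (1 - z) times the product
    of the S(x p_i) for i before l; the term linear in x repairs the case
    n = 1, which the recursion does not cover.  That product of series is a
    d-fold Cauchy product ([cvg_convolution]).  If some p_j is 1, the law of s_n
    is not determined by the recursion, but then each S(x p_i) is S(x) or
    S(0) = 1 and the equation is an identity ([egf_deterministic]).

    For the expectations the same remark gives a linear recursion: the sum over
    all the slots, minus the probability of an unread packet.  Given n packets,
    the number in slot j has binomial moments C(n, k) p_j^k
    ([pmf_binomial_moment]), so the binomial transform diagonalizes the splitting
    operator: its coefficient of index i is multiplied by the sum of the p_j^i,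
    which explains the denominators ([success_mean_rec]).

    Since all the packets may fall into the same slot, s_n occurs on both sides
    of its recursion, which is therefore not well-founded.  The probability of
    this is the sum of the p_j^n, which is below 1 when n >= 2 and all the p_j
    are below 1 ([sum_pow_lt1]).  This contraction shows that s_n is
    at most n almost surely ([mass1]), whence the integrability and the
    convergence of the series, and that the linear recursion has only one
    solution ([success_mean_unique]). *)

(** * Multinomial coefficients *)

(** Expanding the product amounts to choosing one monomial in each factor. *)
Lemma coef_prod_poly (A : comNzRingType) (d N n : nat) (b : 'I_d -> nat -> A) :
  (n < N)%N ->
  (\prod_(j < d) \poly_(k < N) b j k)`_n =
  \sum_(f : {ffun 'I_d -> 'I_N} | (\sum_(j < d) f j == n)%N)
    \prod_(j < d) b j (f j).
Proof.
move=> nN; under eq_bigr do rewrite poly_def.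
rewrite bigA_distr_bigA coef_sum big_mkcond [RHS]big_mkcond.
apply: eq_bigr => f _ /=.
rewrite scaler_prod -expr_sum coefZ coefXn eq_sym.
by case: eqP => _; rewrite ?mulr1 ?mulr0.
Qed.

(** A product of exponentials is the exponential of the sum; below the order N
    of truncation this holds coefficientwise, by the binomial theorem. *)
Lemma coef_prod_exp_poly (R : realType) (I : Type) (r : seq I)
    (w : I -> {poly R}) (N n : nat) : (n < N)%N ->
  (\prod_(j <- r) \poly_(k < N) ((k`!%:R^-1)%:P * w j ^+ k))`_n =
  (n`!%:R^-1)%:P * (\sum_(j <- r) w j) ^+ n.
Proof.
elim: r n => [|i r IH] n nN.
  rewrite !big_nil coef1 expr0n; case: n {nN} => [|n] /=.
    by rewrite fact0 invr1 mulr1.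
  by rewrite mulr0.
rewrite !big_cons coefM exprDn mulr_sumr (reindex_inj rev_ord_inj) /=.
apply: eq_bigr => -[k kn] _ /=; rewrite subSS subKn//.
rewrite coef_poly IH ?(leq_ltn_trans (leq_subr _ _) nN)//;
  last by rewrite (leq_ltn_trans _ nN).
rewrite mulrACA mulrnAr -mulrnAl -polyCMn -polyCM; congr (_%:P * _).
have F m : m`!%:R != 0 :> R by rewrite pnatr_eq0 -lt0n fact_gt0.
have kn' : (k <= n)%N by [].
have /(congr1 (fun m => m%:R : R)) := bin_fact kn'.
rewrite !natrM => <-.
have C0 : 'C(n, k)%:R != 0 :> R by rewrite pnatr_eq0 -lt0n bin_gt0.
rewrite -mulr_natr; by field; rewrite !F C0.
Qed.

(** The variables are polynomials, so that packets can be coloured by an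
    indeterminate: comparing coefficients then yields the moments of the slot
    counts. *)
Lemma multinomial_theorem (R : realType) (d n : nat)
    (p : 'I_d -> R) (y : 'I_d -> {poly R}) :
  \sum_(f : {ffun 'I_d -> 'I_n.+1})
    (multinomial_pmf p n (fun j => f j))%:P * \prod_(j < d) y j ^+ f j =
  (\sum_(j < d) (p j)%:P * y j) ^+ n.
Proof.
have n0 : n`!%:R != 0 :> R by rewrite pnatr_eq0 -lt0n fact_gt0.
have := @coef_prod_exp_poly R _ (index_enum 'I_d)
  (fun j => (p j)%:P * y j) n.+1 n (ltnSn n).
rewrite (@coef_prod_poly _ d n.+1 n
  (fun j k => (k`!%:R^-1)%:P * ((p j)%:P * y j) ^+ k))//.
move=> /(congr1 (fun u => n`!%:R%:P * u)).
rewrite mulrA -polyCM divff// mul1r => <-.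
rewrite mulr_sumr [RHS]big_mkcond; apply: eq_bigr => f _ /=.
rewrite /multinomial_pmf; case: eqP => _; last by rewrite polyC0 mul0r.
under [in RHS]eq_bigr do rewrite exprMn -polyC_exp mulrA -polyCM.
rewrite big_split/= mulrA; congr (_ * _).
rewrite -(rmorph_prod (@polyC R)) -polyCM big_split/=; congr (_%:P).
by rewrite mulrA prodfV.
Qed.

Lemma coef_affine_exp (R : realType) (a b : R) (n k : nat) :
  ((a%:P + b%:P * 'X) ^+ n)`_k = 'C(n, k)%:R * a ^+ (n - k) * b ^+ k.
Proof.
rewrite exprDn coef_sum.
transitivity (\sum_(i < n.+1)
    if (i == k :> nat) then 'C(n, k)%:R * a ^+ (n - k) * b ^+ k else 0 : R).
  apply: eq_bigr => i _.
  rewrite coefMn exprMn -!polyC_exp mulrA -polyCM coefCM coefXn eq_sym.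
  case: eqP => [->|_]; last by rewrite mulr0 mul0rn.
  by rewrite mulr1 -mulr_natl; ring.
rewrite -big_mkcond/=; case: (ltnP k n.+1) => kn.
  by rewrite (big_pred1 (Ordinal kn)).
by rewrite bin_small// !mul0r big1.
Qed.

Lemma big_split_at (T : Type) (idx : T) (op : Monoid.com_law idx) (d : nat)
    (l : 'I_d) (F : 'I_d -> T) :
  \big[op/idx]_j F j =
  op (op (\big[op/idx]_(j < d | (j < l)%N) F j) (F l))
     (\big[op/idx]_(j < d | (l < j)%N) F j).
Proof.
rewrite (bigID (fun j : 'I_d => (j < l)%N))/= -Monoid.mulmA; congr (op _ _).
rewrite (bigD1 l) ?ltnn//=; congr (op _ _); apply: eq_bigl => j.
by rewrite -leqNgt [in RHS]ltn_neqAle andbC eq_sym.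
Qed.

(** * Moments of the slot counts *)

Section Multinomial.
Variables (R : realType) (d : nat) (p : 'I_d -> R).
Hypothesis hp : prob_vector p.
Variable n : nat.

Local Notation pmf f := (multinomial_pmf p n (fun j => f j : nat)).
Local Notation counts := {ffun 'I_d -> 'I_n.+1}.

Lemma pmf_out (i : 'I_d -> nat) : (\sum_j i j)%N != n -> multinomial_pmf p n i = 0.
Proof. by rewrite /multinomial_pmf => /negPf ->. Qed.

Lemma pmf_ge0 (i : 'I_d -> nat) : 0 <= multinomial_pmf p n i.
Proof.
rewrite /multinomial_pmf; case: ifP => // _.
rewrite mulr_ge0 ?divr_ge0 ?ler0n//; last first.
  by apply: prodr_ge0 => j _; rewrite exprn_ge0//; case/andP: (hp.1 j).
by apply: prodr_ge0 => j _.
Qed.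

(** Colour the packets of slot j by 1 + X and all the others by 1: the total
    becomes 1 + p_j X, and both sides are coefficients of X^k. *)
Lemma pmf_binomial_moment (j : 'I_d) (k : nat) :
  \sum_(f : counts) pmf f * 'C(f j, k)%:R = 'C(n, k)%:R * p j ^+ k.
Proof.
have := multinomial_theorem n p (fun i => if i == j then 1%:P + 1%:P * 'X else 1).
move=> /(congr1 (fun u : {poly R} => u`_k)).
have -> : \sum_(i < d) (p i)%:P * (if i == j then 1%:P + 1%:P * 'X else 1) =
    1%:P + (p j)%:P * 'X :> {poly R}.
  transitivity (\sum_(i < d) ((p i)%:P + (if i == j then (p j)%:P * 'X else 0))).
    apply: eq_bigr => i _; case: eqP => [->|_]; last by rewrite mulr1 addr0.
    by rewrite polyC1 mul1r mulrDr mulr1.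
  by rewrite big_split/= -rmorph_sum/= hp.2 -big_mkcond/= big_pred1_eq.
rewrite coef_affine_exp expr1n mulr1 => <-; rewrite coef_sum.
apply: eq_bigr => f _; rewrite coefCM; congr (_ * _).
rewrite (bigD1 j)//= eqxx big1 => [|i ij]; last by rewrite (negPf ij) expr1n.
by rewrite mulr1 coef_affine_exp !expr1n !mulr1.
Qed.

Lemma pmf_sum1 : (0 < d)%N -> \sum_(f : counts) pmf f = 1.
Proof.
move=> d0; have := pmf_binomial_moment (Ordinal d0) 0.
rewrite bin0 mul1r expr0 => <-.
by apply: eq_bigr => f _; rewrite bin0 mulr1.
Qed.

(** The binomial moment of order k = n only sees the configurations where all the
    packets are in slot j. *)
Lemma pmf_concentrated (j : 'I_d) :
  \sum_(f : counts) pmf f * (f j == n :> nat)%:R = p j ^+ n.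
Proof.
have := pmf_binomial_moment j n; rewrite binn mul1r => <-.
apply: eq_bigr => f _; congr (_ * _%:R).
have := ltn_ord (f j); rewrite ltnS leq_eqVlt => /predU1P[->|fn].
  by rewrite eqxx binn.
by rewrite bin_small// ltn_eqF.
Qed.

(** For n >= 2 these are the configurations in which the algorithm stops before
    reading slot l, where the last packet is alone. *)
Definition late_single (l : 'I_d) (i : 'I_d -> nat) :=
  (i l == 1)%N && (\sum_(j < d | (j < l)%N) i j == n.-1)%N.

Lemma late_singleE (l : 'I_d) (i : 'I_d -> nat) : (\sum_j i j)%N = n ->
  late_single l i = (i l == 1)%N && [forall (j : 'I_d | (l < j)%N), i j == 0%N].
Proof.
rewrite /late_single (big_split_at _ l)/= => E.
case: eqP => //= il; rewrite -sum_nat_eq0.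
set A := (\sum_(j < d | _) _)%N in E *; set B := (\sum_(j < d | (l < j)%N) _)%N in E *.
have {}E : (A + 1 + B)%N = n by rewrite -il -E.
by apply/eqP/eqP; lia.
Qed.

(** Colour the packets by 1 before slot l, by X in it and by 0 after it, and
    compare the coefficients of X. *)
Lemma pmf_late_single (l : 'I_d) : (0 < n)%N ->
  \sum_(f : counts) pmf f * (late_single l (fun j => f j))%:R =
  n%:R * p l * (\sum_(j < d | (j < l)%N) p j) ^+ n.-1.
Proof.
move=> n0.
have := multinomial_theorem n p
  (fun i => if (i < l)%N then 1 else if i == l then 'X else 0).
move=> /(congr1 (fun u : {poly R} => u`_1)).
have -> : \sum_(i < d) (p i)%:P *
      (if (i < l)%N then 1 else if i == l then 'X else 0) =
    (\sum_(j < d | (j < l)%N) p j)%:P + (p l)%:P * 'X :> {poly R}.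
  rewrite (big_split_at _ l)/= ltnn eqxx [X in _ + X]big1 ?addr0.
    rewrite rmorph_sum/=; congr (_ + _); apply: eq_bigr => i ->.
    by rewrite mulr1.
  move=> i li; rewrite ltnNge (ltnW li)/= ifN ?mulr0//.
  by rewrite -val_eqE/= gtn_eqF.
rewrite coef_affine_exp bin1 expr1 subn1 mulrAC => <-; rewrite coef_sum.
apply: eq_bigr => f _; rewrite coefCM.
have [E|/pmf_out->] := eqVneq (\sum_j f j)%N n; last by rewrite !mul0r.
congr (_ * _); rewrite late_singleE// (big_split_at _ l)/= ltnn eqxx.
rewrite big1 ?mul1r; last by move=> i il; rewrite il expr1n.
case: (boolP [forall (j : 'I_d | (l < j)%N), f j == 0%N :> nat]) => [/forallP f0|].
  rewrite big1 ?mulr1 ?andbT ?coefXn ?[1 == _]eq_sym// => i li.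
  by have := f0 i; rewrite li => /eqP ->; rewrite expr0.
rewrite andbF negb_forall => /existsP[i]; rewrite negb_imply => /andP[li fi].
rewrite [X in _ * X](bigD1 i)//= ltnNge (ltnW li)/= ifN.
  by rewrite expr0n (negPf fi) mul0r mulr0 coef0.
by rewrite -val_eqE/= gtn_eqF.
Qed.

End Multinomial.

(** * The stopping rule *)

Lemma bigmin_nat (d : nat) (r : seq nat) (Q : pred nat) :
  let m := \big[minn/d]_(k <- r | Q k) k in
  ((m == d) || Q m) /\ (forall k, k \in r -> Q k -> (m <= k)%N).
Proof.
rewrite /=; elim: r => [|a r [IH1 IH2]]; first by rewrite big_nil eqxx.
rewrite big_cons; case: ifP => Qa; split.
- by rewrite /minn; case: ifP; rewrite ?Qa ?orbT.
- move=> k; rewrite inE geq_min => /orP[/eqP->|kr Qk]; first by rewrite leqnn.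
  by rewrite IH2 ?orbT.
- exact: IH1.
- move=> k; rewrite inE => /orP[/eqP->|]; [by rewrite Qa | exact: IH2].
Qed.

Lemma stop_slot_reached (d n : nat) (i : 'I_d -> nat) : (\sum_j i j)%N = n ->
  (n.-1 <= \sum_(j < d | (j < stop_slot n i)%N) i j)%N.
Proof.
move=> E; rewrite -subn1.
have [H _] := bigmin_nat d (index_iota 1 d.+1)
  (fun k => (n - 1 <= \sum_(j < d | j < k) i j)%N).
rewrite -/(stop_slot n i) in H.
case/orP: H => [/eqP H|//]; rewrite {}H.
rewrite [X in (_ <= X)%N](eq_bigl xpredT) ?E ?leq_subr// => j.
by rewrite ltn_ord.
Qed.

Lemma stop_slot_le_single (d n : nat) (i : 'I_d -> nat) (l : 'I_d) : (1 < n)%N ->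
  late_single n l i -> (stop_slot n i <= l)%N.
Proof.
move=> n1 /andP[_ /eqP E].
have [_ le] := bigmin_nat d (index_iota 1 d.+1)
  (fun k => (n - 1 <= \sum_(j < d | j < k) i j)%N).
apply: le; last by rewrite E subn1.
rewrite mem_index_iota ltnS (ltnW (ltn_ord l)) andbT lt0n; apply/eqP => l0.
by move: E; rewrite l0 big_pred0//; lia.
Qed.

(** The slots read hold at least n - 1 packets, so at most one packet is left. *)
Lemma stop_slot_split (d n : nat) (i : 'I_d -> nat) : (1 < n)%N ->
  (\sum_j i j)%N = n ->
  ((forall j : 'I_d, (stop_slot n i <= j)%N -> i j = 0%N) /\
   forall l, late_single n l i = false) \/
  exists l : 'I_d, [/\ (stop_slot n i <= l)%N, i l = 1%N,
    forall j : 'I_d, (stop_slot n i <= j)%N -> j != l -> i j = 0%N &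
    forall l', late_single n l' i = (l' == l)].
Proof.
move=> n1 E; have := stop_slot_reached E.
have := E; rewrite (bigID (fun j : 'I_d => (j < stop_slot n i)%N))/=.
set A := (\sum_(j < d | (j < _)%N) _)%N => E' An.
have [tail0|tail0] := eqVneq (\sum_(j < d | ~~ (j < stop_slot n i)%N) i j)%N 0%N.
  left; have z (j : 'I_d) : (stop_slot n i <= j)%N -> i j = 0%N.
    move=> kj; move/eqP: tail0; rewrite sum_nat_eq0 => /forallP/(_ j).
    by rewrite -leqNgt kj => /eqP.
  split=> // l; apply/negbTE/negP => ls.
  by have := ls; rewrite /late_single z// stop_slot_le_single.
right; have tail1 : (\sum_(j < d | ~~ (j < stop_slot n i)%N) i j)%N = 1%N.
  move: tail0 E' An; set B := bigop.body _ _ _; lia.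
move: tail0; rewrite sum_nat_eq0 negb_forall => /existsP[l].
rewrite negb_imply -leqNgt => /andP[kl il0].
move: tail1; rewrite (bigD1 l) -?leqNgt//= => tail1.
have il : i l = 1%N.
  by move: tail1 il0; set B := bigop.body _ _ _; lia.
have z (j : 'I_d) : (stop_slot n i <= j)%N -> j != l -> i j = 0%N.
  move=> kj jl; move: tail1; rewrite il => -[] /eqP.
  by rewrite sum_nat_eq0 => /forallP/(_ j); rewrite -leqNgt kj jl => /eqP.
exists l; split=> // l'; apply/idP/eqP => [ls|->].
  apply/eqP/negPn/negP => l'l.
  by have := ls; rewrite /late_single z// stop_slot_le_single.
rewrite late_singleE// il eqxx/=; apply/forallP => j; apply/implyP => lj.
by rewrite z// ?(leq_trans kl (ltnW lj))// -val_eqE/= gtn_eqF.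
Qed.

(** When the empty slots contribute the neutral element, stopping changes an
    aggregate over the slots only through the unread packet: not at all if there
    is none, by the factor of slot l if it is there. *)
Lemma big_stop_slot0 (T : Type) (idx : T) (op : Monoid.com_law idx) (d k : nat)
    (i : 'I_d -> nat) (F : nat -> T) : F 0%N = idx ->
  (forall j : 'I_d, (k <= j)%N -> i j = 0%N) ->
  \big[op/idx]_(j < d | (j < k)%N) F (i j) = \big[op/idx]_j F (i j).
Proof.
move=> F0 z; rewrite [RHS](bigID (fun j : 'I_d => (j < k)%N))/=.
rewrite [X in op _ X]big1 ?Monoid.mulm1// => j.
by rewrite -leqNgt => kj; rewrite z.
Qed.

Lemma big_stop_slot1 (T : Type) (idx : T) (op : Monoid.com_law idx) (d k : nat)
    (l : 'I_d) (i : 'I_d -> nat) (F : nat -> T) : F 0%N = idx ->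
  (k <= l)%N -> (forall j : 'I_d, (k <= j)%N -> j != l -> i j = 0%N) ->
  \big[op/idx]_(j < d | (j < k)%N) F (i j) =
    \big[op/idx]_(j < d | (j < l)%N) F (i j) /\
  \big[op/idx]_j F (i j) =
    op (\big[op/idx]_(j < d | (j < k)%N) F (i j)) (F (i l)).
Proof.
move=> F0 kl z.
have E : \big[op/idx]_(j < d | (j < k)%N) F (i j) =
    \big[op/idx]_(j < d | (j < l)%N) F (i j).
  rewrite [RHS](bigID (fun j : 'I_d => (j < k)%N))/=.
  rewrite [X in op _ X]big1 ?Monoid.mulm1 => [|j].
    by apply: eq_bigl => j; rewrite andbC; case: ltnP => // /leq_trans ->.
  rewrite -leqNgt => /andP[jl kj].
  by rewrite z// -val_eqE/= ltn_eqF.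
split=> //; rewrite E (big_split_at op l)/=.
rewrite [X in op _ X]big1 ?Monoid.mulm1// => j lj.
by rewrite z ?(leq_trans kl (ltnW lj))// -val_eqE/= gtn_eqF.
Qed.

(** An unread packet would contribute a factor G 1 = z, so the product over the
    slots read exceeds the full one by 1 - z times itself; it is also the product
    over the slots before l, those between being empty. *)
Lemma prod_stop_slot (R : realType) (d n : nat) (i : 'I_d -> nat)
    (G : nat -> R) (z : R) : (1 < n)%N -> (\sum_j i j)%N = n ->
  G 0%N = 1 -> G 1%N = z ->
  \prod_(j < d | (j < stop_slot n i)%N) G (i j) =
  \prod_j G (i j) +
  \sum_l (late_single n l i)%:R * ((1 - z) * \prod_(j < d | (j < l)%N) G (i j)).
Proof.
move=> n1 E G0 G1; have [[z0 ls0]|[l [kl il z0 lsl]]] := stop_slot_split n1 E.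
  rewrite (big_stop_slot0 _ G0)// [X in _ + X]big1 ?addr0// => l _.
  by rewrite ls0 mul0r.
have [Ek ->] := big_stop_slot1 *%R G0 kl z0.
rewrite [X in _ + X](bigD1 l)//= lsl eqxx mul1r [X in _ + (_ + X)]big1 => [|l' ll']; last first.
  by rewrite lsl (negPf ll') mul0r.
by rewrite -Ek il G1; ring.
Qed.

Lemma sum_stop_slot (R : realType) (d n : nat) (i : 'I_d -> nat)
    (S : nat -> R) : (1 < n)%N -> (\sum_j i j)%N = n ->
  S 0%N = 0 -> S 1%N = 1 ->
  \sum_(j < d | (j < stop_slot n i)%N) S (i j) =
  \sum_j S (i j) - \sum_l (late_single n l i)%:R.
Proof.
move=> n1 E S0 S1; have [[z0 ls0]|[l [kl il z0 lsl]]] := stop_slot_split n1 E.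
  rewrite (big_stop_slot0 _ S0)// [X in _ - X]big1 ?subr0// => l _.
  by rewrite ls0.
have [Ek ->] := big_stop_slot1 +%R S0 kl z0.
rewrite [X in _ - X](bigD1 l)//= lsl eqxx [X in _ - (_ + X)]big1 => [|l' ll']; last first.
  by rewrite lsl (negPf ll').
by rewrite il S1 mulr1n addr0 addrK.
Qed.

(** * The expected number of successes *)

Lemma sum_pow_lt1 (R : realType) (d : nat) (p : 'I_d -> R) (n : nat) :
  prob_vector p -> (forall j, p j < 1) -> (1 < n)%N -> \sum_j p j ^+ n < 1.
Proof.
move=> hp p1 n1; have p0 j : 0 <= p j by case/andP: (hp.1 j).
have [j pj] : exists j, 0 < p j.
  apply/not_existsP => H; have := hp.2; rewrite big1 => [/eqP|j _].
    by rewrite eq_sym oner_eq0.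
  by apply/eqP; rewrite eq_le p0 leNgt andbT; apply/negP/H.
rewrite -hp.2 (bigD1 j)//= [ltRHS](bigD1 j)//= ltr_leD//.
  by case: n n1 => [|[|n]]// _; rewrite exprS gtr_pMr// exprn_ilt1// ltW.
apply: ler_sum => i _; case: n n1 => // n _.
by rewrite exprS ler_piMr// exprn_ile1// ltW.
Qed.

(** Up to sign, the derivative of (1 - y)^n in y. *)
Lemma sum_binomial_derivative (R : realType) (n : nat) (y : R) : (0 < n)%N ->
  \sum_(i < n.+1) 'C(n, i)%:R * (i%:R * (-1) ^+ (i - 1) * y ^+ (i - 1)) =
  n%:R * (1 - y) ^+ n.-1.
Proof.
case: n => // n _; rewrite big_ord_recl !mul0r mulr0 add0r exprDn mulr_sumr.
apply: eq_bigr => i _; rewrite lift0 subn1 /=.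
have E : n.+1%:R * 'C(n, i)%:R = i.+1%:R * 'C(n.+1, i.+1)%:R :> R.
  by rewrite -!natrM mul_bin_diag.
transitivity (n.+1%:R * 'C(n, i)%:R * ((-1) ^+ i * y ^+ i)).
  by rewrite E; ring.
by rewrite expr1n mul1r (exprNn y) -[X in _ = _ * X]mulr_natr; ring.
Qed.

Section ClosedForm.
Variables (R : realType) (d : nat) (p : 'I_d -> R).
Hypotheses (hp : prob_vector p) (p1 : forall j, p j < 1).

(** The binomial transform of the expected numbers of successes.  For i = 1 the
    fraction is 0 / 0; the values at 0 and 1 are set by s_0 = 0 and s_1 = 1. *)
Definition success_coef (i : nat) : R :=
  if (i <= 1)%N then i%:R
  else (-1) ^+ (i - 1) * i%:R * (1 - \sum_(k < d) p k * Fbar p k ^+ (i - 1)) /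
       (1 - \sum_(j < d) p j ^+ i).

Definition success_mean (n : nat) : R :=
  \sum_(i < n.+1) 'C(n, i)%:R * success_coef i.

(** In this form without a quotient, i = 0 and i = 1 are no exceptions. *)
Lemma success_coefE (i : nat) :
  success_coef i * (1 - \sum_(j < d) p j ^+ i) =
  i%:R * (-1) ^+ (i - 1) * (1 - \sum_(k < d) p k * Fbar p k ^+ (i - 1)).
Proof.
rewrite /success_coef; case: ltnP => [i1|].
  rewrite divfK; first by ring.
  by rewrite subr_eq0 eq_sym lt_eqF// sum_pow_lt1.
case: i => [|[|//]] _; first by rewrite !mul0r.
under eq_bigr do rewrite expr1.
under [in RHS]eq_bigr do rewrite mulr1.
by rewrite hp.2 subrr !mulr0.
Qed.

Lemma success_mean_widen (m n : nat) : (m <= n)%N ->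
  success_mean m = \sum_(i < n.+1) 'C(m, i)%:R * success_coef i.
Proof.
move=> mn; rewrite /success_mean.
rewrite (big_ord_widen n.+1 (fun i => 'C(m, i)%:R * success_coef i)) ?ltnS//.
rewrite big_mkcond; apply: eq_bigr => i _; case: ltnP => // mi.
by rewrite bin_small// mul0r.
Qed.

(** By the binomial moments of the slot counts, splitting multiplies the
    coefficient of index i by the sum of the p_j^i; the last sum of the statement
    then follows from the binomial theorem. *)
Lemma success_mean_rec (n : nat) : (1 < n)%N ->
  success_mean n =
  \sum_j \sum_(f : {ffun 'I_d -> 'I_n.+1})
    multinomial_pmf p n (fun j => f j) * success_mean (f j) -
  \sum_(l < d) n%:R * p l * (1 - Fbar p l) ^+ n.-1.
Proof.
move=> n1.
have -> : \sum_j \sum_(f : {ffun 'I_d -> 'I_n.+1})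
    multinomial_pmf p n (fun j => f j) * success_mean (f j) =
    \sum_(i < n.+1) 'C(n, i)%:R * success_coef i * \sum_j p j ^+ i.
  under [RHS]eq_bigr do rewrite mulr_sumr.
  rewrite [RHS]exchange_big/=; apply: eq_bigr => j _.
  transitivity (\sum_(f : {ffun 'I_d -> 'I_n.+1}) \sum_(i < n.+1)
      multinomial_pmf p n (fun j => f j) * 'C(f j, i)%:R * success_coef i).
    apply: eq_bigr => f _; rewrite (@success_mean_widen _ n) -1?ltnS//.
    by rewrite mulr_sumr; apply: eq_bigr => i _; rewrite mulrA.
  rewrite exchange_big/=; apply: eq_bigr => i _.
  by rewrite -mulr_suml pmf_binomial_moment//; ring.
have H : success_mean n -
    \sum_(i < n.+1) 'C(n, i)%:R * success_coef i * \sum_j p j ^+ i =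
    - \sum_(l < d) n%:R * p l * (1 - Fbar p l) ^+ n.-1.
  rewrite /success_mean -sumrB.
  transitivity (\sum_(i < n.+1) ('C(n, i)%:R * (i%:R * (-1) ^+ (i - 1) * 1 ^+ (i - 1))
      - \sum_(k < d) p k * ('C(n, i)%:R * (i%:R * (-1) ^+ (i - 1) * Fbar p k ^+ (i - 1))))).
    apply: eq_bigr => i _.
    transitivity ('C(n, i)%:R * (success_coef i * (1 - \sum_(j < d) p j ^+ i))).
      by ring.
    transitivity ('C(n, i)%:R * (i%:R * (-1) ^+ (i - 1) * 1 ^+ (i - 1)) -
        ('C(n, i)%:R * (i%:R * (-1) ^+ (i - 1))) *
        \sum_(k < d) p k * Fbar p k ^+ (i - 1)).
      by rewrite success_coefE expr1n; ring.
    by rewrite mulr_sumr; congr (_ - _); apply: eq_bigr => k _; ring.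
  rewrite sumrB sum_binomial_derivative ?(ltnW n1)// subrr.
  rewrite expr0n -[n.-1]prednK; last by lia.
  rewrite mulr0 sub0r exchange_big/=; congr (- _); apply: eq_bigr => k _.
  rewrite -mulr_sumr sum_binomial_derivative ?(ltnW n1)//.
  by rewrite prednK; [ring | lia].
by rewrite -H addrCA subrr addr0.
Qed.

(** The difference of two solutions vanishes below n by induction, so only the
    configurations with all the packets in one slot contribute to it at n; they
    multiply it by the sum of the p_j^n, which differs from 1. *)
Lemma success_mean_unique (S : nat -> R) : S 0%N = 0 -> S 1%N = 1 ->
  (forall n, (1 < n)%N ->
    S n = \sum_(f : {ffun 'I_d -> 'I_n.+1})
      multinomial_pmf p n (fun j => f j) *
      \sum_(j < d | (j < stop_slot n (fun j => f j))%N) S (f j)) ->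
  forall n, S n = success_mean n.
Proof.
move=> S0 S1 Srec.
have {}Srec n : (1 < n)%N -> S n = \sum_j \sum_(f : {ffun 'I_d -> 'I_n.+1})
    multinomial_pmf p n (fun j => f j) * S (f j) -
  \sum_(l < d) n%:R * p l * (1 - Fbar p l) ^+ n.-1.
  move=> n1; rewrite Srec// exchange_big/=.
  transitivity (\sum_(f : {ffun 'I_d -> 'I_n.+1})
     (\sum_j multinomial_pmf p n (fun j => f j) * S (f j) -
      \sum_l multinomial_pmf p n (fun j => f j) * (late_single n l (fun j => f j))%:R)).
    apply: eq_bigr => f _.
    have [E|/(pmf_out p)->] := eqVneq (\sum_j f j)%N n; last first.
      by rewrite mul0r !big1 ?subrr// => j _; rewrite mul0r.
    by rewrite (sum_stop_slot n1 E S0 S1) mulrBr !mulr_sumr.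
  rewrite sumrB; congr (_ - _); rewrite exchange_big/=; apply: eq_bigr => l _.
  rewrite pmf_late_single ?(ltnW n1)//; congr (_ * _ ^+ _).
  rewrite -hp.2 /Fbar [in RHS](bigID (fun j : 'I_d => (j < l)%N))/=.
  under [X in _ = _ - X]eq_bigl do rewrite leqNgt.
  by rewrite addrK.
elim/ltn_ind => n IH; case: n IH => [|[|n]] IH.
- by rewrite S0 /success_mean big_ord1 /success_coef mulr0.
- by rewrite S1 /success_mean big_ord_recr big_ord1 /success_coef/= mulr0 add0r mulr1.
set m := n.+2 in IH *.
have E : S m - success_mean m = (\sum_j p j ^+ m) * (S m - success_mean m).
  rewrite [in LHS]Srec// [in LHS]success_mean_rec// opprB addrA subrK -sumrB.
  rewrite mulr_suml; apply: eq_bigr => j _.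
  rewrite -sumrB -(pmf_concentrated hp) mulr_suml; apply: eq_bigr => f _.
  rewrite -mulrBr -mulrA; congr (_ * _).
  have [->|fm] := eqVneq (f j : nat) m; first by rewrite mul1r.
  rewrite mul0r IH ?subrr// ltn_neqAle fm/= -ltnS; exact: ltn_ord.
have : (1 - \sum_j p j ^+ m) * (S m - success_mean m) = 0.
  by rewrite mulrBl mul1r -E subrr.
move/eqP; rewrite mulf_eq0 subr_eq0 gt_eqF ?sum_pow_lt1//= subr_eq0.
by move/eqP.
Qed.

Lemma success_meanE (n : nat) :
  success_mean n = n%:R + \sum_(2 <= i < n.+1)
    'C(n, i)%:R *
     (((-1) ^+ (i - 1) * i%:R *
         (1 - \sum_(k < d) p k * Fbar p k ^+ (i - 1))) /
            (1 - \sum_(j < d) p j ^+ i)).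
Proof.
rewrite /success_mean -(big_mkord xpredT (fun i => 'C(n, i)%:R * success_coef i)).
case: n => [|n].
  by rewrite big_nat1 big_geq// /success_coef mulr0 addr0.
rewrite big_ltn// big_ltn// /success_coef/= mulr0 add0r bin1 mulr1; congr (_ + _).
by apply: eq_big_nat => i /andP[i2 _]; rewrite leqNgt i2.
Qed.

End ClosedForm.

(** * Cauchy products of d series *)

Section CauchyProduct.
Variables (R : realType) (d : nat).
Implicit Types b : 'I_d -> nat -> R.

Definition convolution b (n : nat) : R :=
  \sum_(f : {ffun 'I_d -> 'I_n.+1} | (\sum_j f j == n)%N) \prod_j b j (f j).

Lemma coef_prod_congr (I : Type) (r : seq I) (u v : I -> {poly R}) (n : nat) :
  (forall i k, (k <= n)%N -> (u i)`_k = (v i)`_k) ->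
  (\prod_(i <- r) u i)`_n = (\prod_(i <- r) v i)`_n.
Proof.
move=> uv; suff : forall k, (k <= n)%N ->
    (\prod_(i <- r) u i)`_k = (\prod_(i <- r) v i)`_k by apply.
elim: r => [|i r IH] k kn; first by rewrite !big_nil.
rewrite !big_cons !coefM; apply: eq_bigr => j _.
have jk : (j <= k)%N by rewrite -ltnS ltn_ord.
by rewrite uv ?(leq_trans jk)// IH// (leq_trans (leq_subr _ _)).
Qed.

(** The truncation order can be any N > n, which lets one box serve for all the
    coefficients of a partial sum. *)
Lemma convolution_widen b (n N : nat) : (n < N)%N -> convolution b n =
  \sum_(f : {ffun 'I_d -> 'I_N} | (\sum_j f j == n)%N) \prod_j b j (f j).
Proof.
move=> nN; rewrite /convolution -!coef_prod_poly//.
apply: coef_prod_congr => j k kn.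
by rewrite !coef_poly ltnS kn (leq_ltn_trans kn).
Qed.

Lemma series_convolution b (N : nat) : series (convolution b) N =
  \sum_(f : {ffun 'I_d -> 'I_N} | (\sum_j f j < N)%N) \prod_j b j (f j).
Proof.
rewrite /series/= big_mkord.
under [LHS]eq_bigr => n _ do rewrite (convolution_widen b (ltn_ord n)) big_mkcond.
rewrite exchange_big [RHS]big_mkcond/=; apply: eq_bigr => f _.
case: ltnP => fN.
  rewrite (bigD1 (Ordinal fN))//= eqxx [X in _ + X]big1 ?addr0// => n.
  by rewrite -val_eqE/= eq_sym => /negPf ->.
rewrite big1// => n _; rewrite ifN// gtn_eqF//.
exact: leq_trans (ltn_ord n) fN.
Qed.

Lemma prod_series b (N : nat) : \prod_j series (b j) N =
  \sum_(f : {ffun 'I_d -> 'I_N}) \prod_j b j (f j).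
Proof.
rewrite -(bigA_distr_bigA (fun j (k : 'I_N) => b j k)).
by apply: eq_bigr => j _; rewrite /series/= big_mkord.
Qed.

(** A multi-index in the box of side N with total at least N has a coordinate at
    least N / d, so it lies outside the smaller box of side N / d.  The bound
    tends to 0, since the two products have the same limit. *)
Lemma convolution_remainder b (N : nat) : (0 < d)%N ->
  `|series (convolution b) N - \prod_j series (b j) N| <=
  \prod_j series (fun k => `|b j k|) N -
  \prod_j series (fun k => `|b j k|) (N %/ d)%N.
Proof.
move=> d0; rewrite series_convolution prod_series.
rewrite [X in _ - X](bigID (fun f : {ffun 'I_d -> 'I_N} => (\sum_j f j < N)%N))/=.
rewrite opprD addrA subrr sub0r normrN (prod_series (fun j k => `|b j k|)).
rewrite lerBrDr; apply: le_trans (lerD (ler_norm_sum _ _ _) (lexx _)) _.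
rewrite [leRHS](bigID (fun f : {ffun 'I_d -> 'I_N} => (\sum_j f j < N)%N))/= addrC.
apply: lerD; first by apply: ler_sum => f _; rewrite normr_prod.
have MN : (N %/ d <= N)%N by rewrite leq_div.
have -> : \prod_j series (fun k => `|b j k|) (N %/ d)%N =
    \sum_(f : {ffun 'I_d -> 'I_N})
      \prod_j (if (f j < N %/ d)%N then `|b j (f j)| else 0).
  rewrite -(bigA_distr_bigA (fun j (k : 'I_N) =>
    if (k < N %/ d)%N then `|b j k| else 0)).
  apply: eq_bigr => j _; rewrite /series/= big_mkord.
  by rewrite (big_ord_widen _ (fun k => `|b j k|) MN) big_mkcond.
rewrite [leRHS]big_mkcond/=; apply: ler_sum => f _.
have [/forallP fM|] := boolP [forall j, (f j < N %/ d)%N].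
  rewrite ifT.
    rewrite le_eqVlt (eq_bigr (fun j => `|b j (f j)|)) ?eqxx// => j _.
    by rewrite fM.
  have : (\sum_(j < d) (f j).+1 <= \sum_(j < d) (N %/ d))%N by exact: leq_sum.
  rewrite [X in (_ <= X)%N -> _]sum_nat_const card_ord mulnC.
  have -> : (\sum_(j < d) (f j).+1 = \sum_j f j + d)%N.
    under [LHS]eq_bigr do rewrite -addn1.
    by rewrite big_split/= sum_nat_const card_ord muln1.
  move=> /leq_trans-/(_ _ (leq_divM N d)); apply: leq_trans.
  by rewrite -addn1 leq_add2l.
rewrite negb_forall => /existsP[j fj]; rewrite (bigD1 j)//= (negPf fj) mul0r.
by case: ifP => // _; apply: prodr_ge0.
Qed.

Lemma cvgn_prod (I : Type) (r : seq I) (u : I -> nat -> R) (l : I -> R) :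
  (forall i, u i @ \oo --> l i) ->
  (fun n => \prod_(i <- r) u i n) @ \oo --> \prod_(i <- r) l i.
Proof.
move=> ul; elim: r => [|i r IH].
  by under eq_fun do rewrite big_nil; rewrite big_nil; exact: cvg_cst.
under eq_fun do rewrite big_cons.
by rewrite big_cons; exact: cvgM.
Qed.

Lemma cvg_divn : (0 < d)%N -> (fun N => (N %/ d)%N) @ \oo --> \oo.
Proof.
move=> d0 A [M _ MA]; exists (M * d)%N => // N /= MN; apply: MA => /=.
by rewrite leq_divRL.
Qed.

Lemma cvg_convolution b : (0 < d)%N ->
  (forall j, cvgn (series (fun k => `|b j k|))) ->
  series (convolution b) @ \oo --> \prod_j limn (series (b j)).
Proof.
move=> d0 cb; set A := fun j => series (fun k => `|b j k|).
have cA : (fun N => \prod_j A j N) @ \oo --> \prod_j limn (A j).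
  by apply: cvgn_prod => j; exact: cb.
have cA' : (fun N => \prod_j A j (N %/ d)%N) @ \oo --> \prod_j limn (A j).
  exact: (cvg_comp _ _ (cvg_divn d0) cA).
have cB : (fun N => \prod_j series (b j) N) @ \oo --> \prod_j limn (series (b j)).
  by apply: cvgn_prod => j; have := normed_cvg (cb j); exact.
have c0 : (fun N => series (convolution b) N - \prod_j series (b j) N) @ \oo --> 0.
  apply: norm_cvg0.
  apply: (@squeeze_cvgr _ _ _ _ (fun=> 0)
    (fun N => \prod_j A j N - \prod_j A j (N %/ d)%N)).
  - near=> N; rewrite normr_ge0/=; exact: convolution_remainder.
  - exact: cvg_cst.
  - by rewrite -(subrr (\prod_j limn (A j))); exact: cvgB.
suff -> : series (convolution b) =
    (fun N => series (convolution b) N - \prod_j series (b j) N) +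
    (fun N => \prod_j series (b j) N).
  by rewrite -[X in _ --> X]add0r; exact: cvgD.
by apply/funext => N; rewrite fctE subrK.
Unshelve. all: by end_near. Qed.

End CauchyProduct.

Lemma cvg_series_single (R : realType) (m : nat) (c : R) :
  series (fun n => if n == m then c else 0) @ \oo --> c.
Proof.
apply: cvg_near_cst; near=> n.
rewrite /series/= big_mkord.
have mn : (m < n)%N by near: n; exists m.+1.
by rewrite -big_mkcond/= (big_pred1 (Ordinal mn)).
Unshelve. all: by end_near. Qed.

(** * The functional equation *)

Section FunctionalEquation.
Variables (R : realType) (d : nat) (p : 'I_d -> R).
Hypotheses (hp : prob_vector p) (d0 : (0 < d)%N).

(** The exponential generating function of a multinomial splitting is a product:
    the factorials of the weights are absorbed by those of the series. *)
Lemma pmf_convolution (w : 'I_d -> nat -> R) (x : R) (n : nat) :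
  convolution (fun j m => (x * p j) ^+ m / m`!%:R * w j m) n =
  x ^+ n / n`!%:R * \sum_(f : {ffun 'I_d -> 'I_n.+1})
    multinomial_pmf p n (fun j => f j) * \prod_j w j (f j).
Proof.
rewrite /convolution mulr_sumr big_mkcond; apply: eq_bigr => f _ /=.
case: eqP => E; last first.
  by rewrite pmf_out ?mul0r ?mulr0//; apply/eqP.
rewrite /multinomial_pmf E eqxx !big_split/= prodfV.
under [X in X / _ * _ = _]eq_bigr do rewrite exprMn.
rewrite big_split/= -expr_sum E.
have n0 : n`!%:R != 0 :> R by rewrite pnatr_eq0 -lt0n fact_gt0.
have P0 : \prod_(j < d) (f j)`!%:R != 0 :> R.
  by apply/prodf_neq0 => j _; rewrite pnatr_eq0 -lt0n fact_gt0.
by field; rewrite n0 P0.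
Qed.

Variables (z : R) (G : nat -> R) (K : R).
Hypotheses (G0 : G 0%N = 1) (G1 : G 1%N = z).
Hypothesis Grec : forall n, (1 < n)%N -> G n =
  \sum_(f : {ffun 'I_d -> 'I_n.+1}) multinomial_pmf p n (fun j => f j) *
    \prod_(j < d | (j < stop_slot n (fun j => f j))%N) G (f j).
Hypothesis GK : forall n, `|G n| <= K ^+ n.

Let o : 'I_d := Ordinal d0.

(** For n >= 2 this is the recursion, rewritten by [prod_stop_slot].  For n = 1
    the two sums give z + (1 - p_o) (1 - z) instead of z, which the first term
    compensates. *)
Lemma pgf_expansion (n : nat) : G n =
  (if n == 1%N then (1 - p o) * (z - 1) else 0) +
  \sum_(f : {ffun 'I_d -> 'I_n.+1})
    multinomial_pmf p n (fun j => f j) * \prod_j G (f j) +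
  \sum_(l < d | (1 <= l)%N) \sum_(f : {ffun 'I_d -> 'I_n.+1})
    multinomial_pmf p n (fun j => f j) *
    ((late_single n l (fun j => f j))%:R *
      ((1 - z) * \prod_(j < d | (j < l)%N) G (f j))).
Proof.
case: n => [|[|n]].
- rewrite add0r [X in _ + X]big1 ?addr0 => [|l _].
    rewrite G0 -[LHS](pmf_sum1 hp 0 d0); apply: eq_bigr => f _.
    by rewrite [X in _ * X]big1 ?mulr1// => j _; rewrite ord1.
  by apply: big1 => f _; rewrite /late_single ord1 mul0r mulr0.
- have -> : \sum_(f : {ffun 'I_d -> 'I_2})
      multinomial_pmf p 1 (fun j => f j) * \prod_j G (f j) = z.
    rewrite -[RHS]mulr1 -[X in z * X](pmf_sum1 hp 1 d0) mulr_sumr; apply: eq_bigr => f _.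
    have [E|/(pmf_out p)->] := eqVneq (\sum_j f j)%N 1%N; last by rewrite mulr0 mul0r.
    rewrite mulrC; congr (_ * _).
    transitivity (\prod_j z ^+ f j); last by rewrite -expr_sum E expr1.
    apply: eq_bigr => j _; case: (f j) => -[|[|//]] i /=.
      by rewrite G0 expr0.
    by rewrite G1 expr1.
  have -> : \sum_(l < d | (1 <= l)%N) \sum_(f : {ffun 'I_d -> 'I_2})
    multinomial_pmf p 1 (fun j => f j) *
    ((late_single 1 l (fun j => f j))%:R *
      ((1 - z) * \prod_(j < d | (j < l)%N) G (f j))) =
    (1 - z) * \sum_(l < d | (1 <= l)%N) p l.
    rewrite mulr_sumr; apply: eq_bigr => l _.
    have := pmf_late_single p l (ltn0Sn 0); rewrite /= expr0 mulr1 mul1r => <-.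
    rewrite mulr_sumr; apply: eq_bigr => f _.
    case: (boolP (late_single _ _ _)) => [/andP[_ ]|_]; last by rewrite mul0r !mulr0.
    rewrite sum_nat_eq0 => /forallP z0.
    rewrite big1 => [|j jl]; first by rewrite mulr1; ring.
    by have := z0 j; rewrite jl => /eqP ->.
  have -> : \sum_(l < d | (1 <= l)%N) p l = 1 - p o.
    rewrite -hp.2 [in RHS](bigD1 o)//= addrC addrK; apply: eq_bigl => l.
    by rewrite lt0n -val_eqE.
  by rewrite eqxx G1; ring.
- rewrite add0r Grec// [X in _ + X]exchange_big/= -big_split/=.
  apply: eq_bigr => f _.
  have [E|/(pmf_out p)->] := eqVneq (\sum_j f j)%N n.+2; last first.
    by rewrite !mul0r add0r big1// => l _; rewrite mul0r.
  rewrite (@prod_stop_slot _ _ _ _ G z) // mulrDr; congr (_ + _).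
  rewrite mulr_sumr [in LHS](bigID (fun l : 'I_d => (1 <= l)%N))/=.
  rewrite [X in _ + X]big1 ?addr0// => l; rewrite -ltnNge ltnS leqn0 => /eqP l0.
  suff -> : late_single n.+2 l (fun j => f j) = false by rewrite mul0r mulr0.
  by rewrite /late_single l0 big_pred0 ?andbF// => j; rewrite ltn0.
Qed.

Definition pgf_term (x : R) (n : nat) : R := x ^+ n / n`!%:R * G n.

Lemma is_cvg_series_pgf_term (x : R) :
  cvgn (series (fun n => `|pgf_term x n|)).
Proof.
apply: (@series_le_cvg _ _ (exp_coeff (`|x| * K))) => [n|n|n|].
- exact: normr_ge0.
- have K0 : 0 <= K by have := le_trans (normr_ge0 _) (GK 1); rewrite expr1.
  by rewrite /exp_coeff/= divr_ge0// exprn_ge0// mulr_ge0.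
- rewrite /pgf_term /exp_coeff/= !normrM normfV normrX exprMn normr_nat.
  by rewrite mulrAC ler_wpM2r// ler_wpM2l// exprn_ge0.
- exact: is_cvg_series_exp_coeff.
Qed.

(** Weights that make the indicator of [late_single] a product over the slots:
    any number of packets before l, exactly one in l, none after l. *)
Definition late_factor (l j : 'I_d) (m : nat) : R :=
  if (j < l)%N then G m
  else if j == l then (if m == 1%N then 1 - z else 0)
  else if m == 0%N then 1 else 0.

Lemma prod_late_factor (n : nat) (l : 'I_d) (i : 'I_d -> nat) :
  (\sum_j i j)%N = n ->
  \prod_j late_factor l j (i j) = (late_single n l i)%:R *
      ((1 - z) * \prod_(j < d | (j < l)%N) G (i j)).
Proof.
move=> E; rewrite (big_split_at _ l)/= late_singleE// /late_factor ltnn eqxx.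
rewrite (eq_bigr (fun j => G (i j))) => [|j ->//].
case: (i l == 1%N) => /=; last by rewrite mulr0 !mul0r.
case: (boolP [forall (j : 'I_d | (l < j)%N), i j == 0%N]) => [/forallP i0|].
  rewrite [X in _ * X = _]big1 => [|j lj]; first by rewrite mul1r mulr1 mulrC.
  have := i0 j; rewrite lj ltnNge (ltnW lj)/= => /eqP ->.
  by rewrite ifN// -val_eqE/= gtn_eqF.
rewrite negb_forall => /existsP[j]; rewrite negb_imply => /andP[lj ij].
rewrite [X in _ * X = _](bigD1 j)//= ltnNge (ltnW lj)/= ifN.
  by rewrite (negPf ij) !mul0r mulr0.
by rewrite -val_eqE/= gtn_eqF.
Qed.

Lemma pgf_functional_equation (x : R) :
  let S y := limn (series (pgf_term y)) in
  S x = (1 - p o) * x * (z - 1) + \prod_i S (x * p i) +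
    \sum_(k < d | (1 <= k)%N)
      x * p k * (1 - z) * \prod_(i < d | (i < k)%N) S (x * p i).
Proof.
move=> S; apply: cvg_lim => //.
pose e j := pgf_term (x * p j).
pose el l j m := (x * p j) ^+ m / m`!%:R * late_factor l j m.
have -> : pgf_term x = fun n =>
    (if n == 1%N then (1 - p o) * x * (z - 1) else 0) + convolution e n +
    \sum_(l < d | (1 <= l)%N) convolution (el l) n.
  apply/funext => n; rewrite /pgf_term [in LHS]pgf_expansion 2!mulrDr.
  congr (_ + _ + _).
  - case: eqP => [->|_]; last by rewrite mulr0.
    by rewrite expr1 invr1; ring.
  - by rewrite pmf_convolution.
  - rewrite mulr_sumr; apply: eq_bigr => l _; rewrite pmf_convolution.
    congr (_ * _); apply: eq_bigr => f _.
    have [E|/(pmf_out p)->] := eqVneq (\sum_j f j)%N n; last by rewrite !mul0r.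
    by rewrite (@prod_late_factor n).
have -> : series (fun n =>
    (if n == 1%N then (1 - p o) * x * (z - 1) else 0) + convolution e n +
    \sum_(l < d | (1 <= l)%N) convolution (el l) n) =
  series (fun n => if n == 1%N then (1 - p o) * x * (z - 1) else 0) +
  series (convolution e) +
  (fun N => \sum_(l < d | (1 <= l)%N) series (convolution (el l)) N).
  apply/funext => N; rewrite !fctE /series/= !big_split/=.
  by congr (_ + _); rewrite exchange_big.
apply: cvgD; [apply: cvgD|].
- exact: cvg_series_single.
- by apply: cvg_convolution => // j; exact: is_cvg_series_pgf_term.
- apply: cvg_big => [u|k _]; first exact: add_continuous.
  have ck (j : 'I_d) : (k < j)%N -> el k j = fun m => if m == 0%N then 1 else 0.
    move=> kj; apply/funext => m; rewrite /el /late_factor ltnNge (ltnW kj)/=.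
    rewrite ifN; last by rewrite -val_eqE/= gtn_eqF.
    by case: eqP => [->|_]; rewrite ?mulr0// expr0 invr1 !mulr1.
  have cj (j : 'I_d) : (j < k)%N -> el k j = e j.
    by move=> jk; apply/funext => m; rewrite /el /late_factor jk.
  have cc : el k k = fun m => if m == 1%N then x * p k * (1 - z) else 0.
    apply/funext => m; rewrite /el /late_factor ltnn eqxx.
    by case: eqP => [->|_]; rewrite ?mulr0// expr1 invr1 mulr1.
  have -> : x * p k * (1 - z) * \prod_(i < d | (i < k)%N) S (x * p i) =
      \prod_j limn (series (el k j)).
    rewrite (big_split_at _ k)/= cc.
    rewrite [X in _ = _ * X]big1 => [|j kj]; last first.
      by rewrite ck//; apply: cvg_lim => //; exact: cvg_series_single.
    rewrite mulr1 mulrC; congr (_ * _).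
      by apply: eq_bigr => j jk; rewrite cj.
    by apply/esym/cvg_lim => //; exact: cvg_series_single.
  apply: cvg_convolution => // j.
  have normE c m0 : (fun m : nat => `|if m == m0 then c else 0 : R|) =
      fun m => if m == m0 then `|c| else 0.
    by apply/funext => m; case: ifP; rewrite ?normr0.
  case: (ltngtP j k) => [jk|kj|/val_inj->].
  + by rewrite cj//; exact: is_cvg_series_pgf_term.
  + by rewrite ck// normE; apply: cvgP; exact: cvg_series_single.
  + by rewrite cc normE; apply: cvgP; exact: cvg_series_single.
Qed.

End FunctionalEquation.

(** * Integer random variables with finitely many values *)

Section FiniteValued.
Context d (T : measurableType d) (R : realType) (P : probability T R).

Lemma measurable_preimage_nat (X : {RV P >-> nat}) (D : set nat) :
  measurable (X @^-1` D).
Proof. exact: measurable_funPTI. Qed.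

Lemma prob_fineK (A : set T) : measurable A -> (fine (P A))%:E = P A.
Proof. by move=> mA; rewrite fineK// fin_num_measure. Qed.

Lemma prob_ltE (X : {RV P >-> nat}) (N : nat) :
  P [set t | (X t < N)%N] = (\sum_(m < N) fine (P [set t | X t = m]))%:E.
Proof.
elim: N => [|N IH].
  rewrite big_ord0 (_ : [set t | _] = set0) ?measure0//.
  by apply/seteqP; split.
rewrite big_ord_recr/= EFinD -IH prob_fineK; last first.
  exact: (measurable_preimage_nat X [set N]).
rewrite -measureU.
- congr (P _); apply/seteqP; split=> t /=.
    by rewrite ltnS leq_eqVlt => /predU1P[|]; [right|left].
  by case=> [/ltnW|->].
- exact: (measurable_preimage_nat X [set m | (m < N)%N]).
- exact: (measurable_preimage_nat X [set N]).
- by apply/seteqP; split => // t [/= XN XE]; rewrite XE ltnn in XN.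
Qed.

Lemma sum_disjoint_prob_le (K : finType) (C : pred K) (F : K -> set T)
    (E : set T) : (forall k, measurable (F k)) -> measurable E ->
  trivIset setT F -> (forall k, C k -> F k `<=` E) ->
  (\sum_(k | C k) P (F k) <= P E)%E.
Proof.
move=> mF mE tF FE.
rewrite -big_enum/= fsbig_seq ?enum_uniq//=.
rewrite -measure_fin_bigcup//; last by apply: sub_trivIset tF.
apply: le_measure; rewrite ?inE//.
  by apply: fin_bigcup_measurable.
by apply: bigcup_sub => k /=; rewrite mem_enum; exact: FE.
Qed.

(** The masses below N add up to 1, so X is almost surely below N and h X is
    almost everywhere equal to a simple function. *)
Lemma finite_expectation (X : {RV P >-> nat}) (N : nat) (h : nat -> R) :
  \sum_(m < N) fine (P [set t | X t = m]) = 1 ->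
  P.-integrable setT (EFin \o (fun t => h (X t))) /\
  'E_P[fun t => h (X t)]%E = (\sum_(m < N) fine (P [set t | X t = m]) * h m)%:E.
Proof.
move=> S1; pose A m := [set t | X t = m].
have mA m : measurable (A m) by exact: (measurable_preimage_nat X [set m]).
pose g m t := ((h m)%:E * (\1_(A m) t)%:E)%E.
have ig m : P.-integrable setT (g m).
  apply: integrableZl => //; apply: integrable_indic => //.
have mhX : measurable_fun setT ((EFin \o (fun t => h (X t))) : T -> \bar R).
  apply/measurable_EFinP => _ Y mY; rewrite setTI.
  exact: (measurable_preimage_nat X (h @^-1` Y)).
have ae : ae_eq P setT (EFin \o (fun t => h (X t))) (fun t => \sum_(m < N) g m t)%E.
  exists [set t | (N <= X t)%N]; split.
  - exact: (measurable_preimage_nat X [set m | (N <= m)%N]).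
  - have -> : [set t | (N <= X t)%N] = ~` [set t | (X t < N)%N].
      by apply/seteqP; split => t /=; rewrite (leqNgt N) => /negP.
    have mX : measurable [set t | (X t < N)%N].
      exact: (measurable_preimage_nat X [set m | (m < N)%N]).
    by have := probability_setC P mX; rewrite prob_ltE S1 subee.
  - move=> t /= H; rewrite leqNgt; apply/negP => XN; apply: H => _.
    rewrite (bigD1 (Ordinal XN))//= big1 => [|m /eqP mX].
      by rewrite adde0 /g indicE mem_set// mule1.
    rewrite /g indicE memNset ?mule0// => Xm; apply: mX.
    exact: val_inj.
have isum : P.-integrable setT (fun t => \sum_(m < N) g m t)%E.
  by apply: integrable_sum.
split.
  apply/integrableP; split=> //.
  have /integrableP[_] := isum; apply: le_lt_trans; rewrite le_eqVlt.
  apply/orP; left; apply/eqP; apply: ae_eq_integral => //.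
  - exact: measurableT_comp.
  - by apply: measurableT_comp => //; case/integrableP: isum.
  - by apply: filterS ae => t H /H; exact: (congr1 abse).
rewrite unlock (ae_eq_integral _ _ _ _ _ ae)//; last by case/integrableP: isum.
rewrite integral_sum// -sumEFin; apply: eq_bigr => m _.
rewrite /g integralZl//; last exact: integrable_indic.
rewrite integral_indic// setIT EFinM prob_fineK; last exact: mA.
by rewrite muleC.
Qed.

End FiniteValued.

(** * The law of the number of successes *)

Lemma weierstrass_prod (R : realType) (I : Type) (r : seq I) (a : I -> R) :
  (forall i, 0 <= a i <= 1) ->
  1 - \prod_(i <- r) a i <= \sum_(i <- r) (1 - a i).
Proof.
move=> a01; suff [] : 0 <= \prod_(i <- r) a i <= 1 /\
  1 - \prod_(i <- r) a i <= \sum_(i <- r) (1 - a i) by [].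
elim: r => [|i r [/andP[p0 p1] IH]]; first by rewrite !big_nil subrr ler01 lexx.
rewrite !big_cons; have /andP[a0 a1] := a01 i; split.
  by rewrite mulr_ge0//= mulr_ile1.
nra.
Qed.

Section Successes.
Variables (R : realType) (d : nat) (p : 'I_d -> R).
Hypotheses (hp : prob_vector p) (p1 : forall j, p j < 1) (d0 : (0 < d)%N).
Variables (dT : measure_display) (T : measurableType dT) (P : probability T R).
Variables (s : nat -> {RV P >-> nat}).
Hypothesis hs : sicta_successes p s.

Definition law (n m : nat) : R := fine (P [set t | s n t = m]).

Lemma lawE (n m : nat) : P [set t | s n t = m] = (law n m)%:E.
Proof.
by rewrite prob_fineK//; exact: (measurable_preimage_nat (s n) [set m]).
Qed.

Lemma law_ge0 (n m : nat) : 0 <= law n m.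
Proof. exact: fine_ge0. Qed.

Lemma law_sum_le1 (n N : nat) : \sum_(m < N) law n m <= 1.
Proof.
rewrite -lee_fin -prob_ltE probability_le1//.
exact: (measurable_preimage_nat (s n) [set m | (m < N)%N]).
Qed.

(** The mass that the recursion gives to m, except that the summands are only
    allowed values at most n; that this loses nothing is [law_rec]. *)
Definition step_law (n m : nat) : R :=
  \sum_(f : {ffun 'I_d -> 'I_n.+1}) \sum_(x : {ffun 'I_d -> 'I_n.+1})
    multinomial_pmf p n (fun j => f j) * \prod_j law (f j) (x j) *
    (\sum_(j < d | (j < stop_slot n (fun j => f j))%N) x j == m)%N%:R.

(** The events that fix all the slot counts and all the summands are disjoint,
    and finitely many of them already give this lower bound. *)
Lemma law_rec_le (n m : nat) : (1 < n)%N -> step_law n m <= law n m.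
Proof.
move=> n1; rewrite /step_law; case: hs => _ _ /(_ n n1) [dT' [T' [Q [I [X [HI HX Hs]]]]]].
pose F (i x : 'I_d -> nat) :=
  [set t | (forall j, I j t = i j) /\ (forall j, X j t = x j)].
pose E := [set t | (\sum_(j < d | (j < stop_slot n (fun l => I l t))%N) X j t)%N = m].
have mF i x : measurable (F i x).
  have -> : F i x = \bigcap_j ([set t | I j t = i j] `&` [set t | X j t = x j]).
    apply/seteqP; split=> t /=; first by move=> [Ii Xx] j _; split.
    by move=> H; split=> j; have [] := H j Logic.I.
  apply: fin_bigcap_measurable => // j _; apply: measurableI.
    exact: (measurable_preimage_nat (I j) [set i j]).
  exact: (measurable_preimage_nat (X j) [set x j]).
have FE i x t : F i x t ->
    (\sum_(j < d | (j < stop_slot n (fun l => I l t))%N) X j t =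
     \sum_(j < d | (j < stop_slot n i)%N) x j)%N.
  move=> [Ii Xx]; have -> : (fun l => I l t) = i by apply/funext => l.
  by apply: eq_bigr => j _; rewrite Xx.
(* E is the union of the events F i x over countably many (i, x). *)
have mE : measurable E.
  have -> : E = \bigcup_(k : {ffun 'I_d -> nat} * {ffun 'I_d -> nat})
      (if (\sum_(j < d | (j < stop_slot n k.1)%N) k.2 j == m)%N
       then F k.1 k.2 else set0).
    apply/seteqP; split=> t /=.
      move=> Et; exists ([ffun j => I j t], [ffun j => X j t]) => //=.
      have Ft : F [ffun j => I j t] [ffun j => X j t] t.
        by split=> j; rewrite ffunE.
      by rewrite -(FE _ _ _ Ft) Et eqxx.
    by move=> [k _] /=; case: eqP => // Ek Ft; rewrite /E/= (FE _ _ _ Ft).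
  by apply: countable_bigcupT_measurable => // k; case: ifP.
rewrite -lee_fin -lawE Hs -/E.
pose K := ({ffun 'I_d -> 'I_n.+1} * {ffun 'I_d -> 'I_n.+1})%type.
pose nF (k : K) := F (fun j => k.1 j) (fun j => k.2 j).
pose C (k : K) := (\sum_(j < d | (j < stop_slot n (fun j => k.1 j))%N) k.2 j == m)%N.
have := @sum_disjoint_prob_le _ T' R Q K C nF E.
move=> /(_ (fun k => mF _ _) mE); rewrite -sumEFin.
have -> : (\sum_(f : {ffun 'I_d -> 'I_n.+1}) (\sum_(x : {ffun 'I_d -> 'I_n.+1})
    multinomial_pmf p n (fun j => f j) * \prod_j law (f j) (x j) *
    (\sum_(j < d | (j < stop_slot n (fun j => f j))%N) x j == m)%N%:R)%:E =
    \sum_(k | C k) Q (nF k))%E.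
  under eq_bigr do rewrite -sumEFin.
  rewrite pair_bigA/= [RHS]big_mkcond; apply: eq_bigr => k _ /=.
  rewrite /C; case: eqP => _; last by rewrite mulr0.
  rewrite mulr1 /nF /F HX HI EFinM -prodEFin; congr (_ * _)%E.
  by apply: eq_bigr => j _; rewrite lawE.
apply.
- move=> [f x] [f' x'] _ _ [t [/= [If Xx] [If' Xx']]]; congr (_, _).
    by apply/ffunP => j; apply/val_inj; rewrite /= -If -If'.
  by apply/ffunP => j; apply/val_inj; rewrite /= -Xx -Xx'.
- by move=> k /eqP Ck t Ft; rewrite /E/= (FE _ _ _ Ft).
Qed.

Definition mass (n : nat) : R := \sum_(m < n.+1) law n m.

Lemma mass_ge0 n : 0 <= mass n.
Proof. by apply: sumr_ge0 => m _; exact: law_ge0. Qed.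

Lemma mass_le1 n : mass n <= 1.
Proof. exact: law_sum_le1. Qed.

Lemma law00 : law 0 0 = 1.
Proof. by case: hs => H _ _; rewrite /law H. Qed.

Lemma law11 : law 1 1 = 1.
Proof. by case: hs => _ H _; rewrite /law H. Qed.

Lemma sum_slots (n : nat) (f : {ffun 'I_d -> 'I_n.+1}) (w : 'I_d -> nat -> R) :
  \sum_(x : {ffun 'I_d -> 'I_n.+1}) \prod_j w j (x j) =
  \prod_j \sum_(m < n.+1) w j m.
Proof. by rewrite -(bigA_distr_bigA (fun j (m : 'I_n.+1) => w j m)). Qed.

(** If each summand is at most its number of packets, then their sum is at most
    n. *)
Lemma mass_rec_le (n : nat) : (1 < n)%N ->
  \sum_(f : {ffun 'I_d -> 'I_n.+1})
    multinomial_pmf p n (fun j => f j) * \prod_j mass (f j) <=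
  \sum_(m < n.+1) step_law n m.
Proof.
move=> n1; rewrite /step_law exchange_big/=; apply: ler_sum => f _.
have [E|/(pmf_out p)->] := eqVneq (\sum_j f j)%N n; last first.
  rewrite mul0r; apply: sumr_ge0 => m _; apply: sumr_ge0 => x _.
  by rewrite !mul0r.
rewrite exchange_big/=.
have -> : \prod_j mass (f j) = \sum_(x : {ffun 'I_d -> 'I_n.+1})
    \prod_j (if (x j <= f j)%N then law (f j) (x j) else 0).
  rewrite (@sum_slots n f (fun j m => if (m <= f j)%N then law (f j) m else 0)).
  apply: eq_bigr => j _; rewrite -big_mkcond/=.
  rewrite /mass (big_ord_widen n.+1 (fun m => law (f j) m))//.
rewrite mulr_sumr; apply: ler_sum => x _.
have L0 : 0 <= \prod_j law (f j) (x j) by apply: prodr_ge0 => j _; exact: law_ge0.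
have [/forallP xf|] := boolP [forall j, (x j <= f j)%N]; last first.
  rewrite negb_forall => /existsP[j /negPf xj].
  rewrite (bigD1 j)//= xj mul0r mulr0.
  by apply: sumr_ge0 => m _; rewrite !mulr_ge0 ?pmf_ge0.
under [in leLHS]eq_bigr do rewrite xf.
have xn : (\sum_(j < d | (j < stop_slot n (fun j => f j))%N) x j < n.+1)%N.
  rewrite ltnS -[leqRHS]E [leqLHS]big_mkcond/=.
  by apply: leq_sum => j _; case: ifP.
rewrite (bigD1 (Ordinal xn))//= eqxx mulr1 lerDl.
by apply: sumr_ge0 => m _; rewrite !mulr_ge0 ?pmf_ge0.
Qed.

(** The recursion is not well-founded, as all the packets may fall into one slot;
    but the missing mass 1 - mass n is at most the sum of the p_j^n times
    itself, and that sum is below 1. *)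
Lemma mass1 (n : nat) : mass n = 1.
Proof.
elim/ltn_ind: n => -[|[|n]] IH.
- by rewrite /mass big_ord1 law00.
- apply/eqP; rewrite eq_le mass_le1/= /mass big_ord_recr big_ord1/= law11.
  by rewrite lerDr law_ge0.
set m := n.+2 in IH *; apply/eqP; rewrite eq_le mass_le1/= -subr_le0.
have : 1 - mass m <= (\sum_j p j ^+ m) * (1 - mass m).
  apply: le_trans (_ : \sum_(f : {ffun 'I_d -> 'I_m.+1})
    multinomial_pmf p m (fun j => f j) * (1 - \prod_j mass (f j)) <= _).
    under [leRHS]eq_bigr do rewrite mulrBr mulr1.
    rewrite sumrB pmf_sum1// lerD2l lerN2.
    apply: le_trans (mass_rec_le _) _ => //; apply: ler_sum => k _.
    exact: law_rec_le.
  rewrite mulr_suml; under [leRHS]eq_bigr => j _ do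
    rewrite -(pmf_concentrated hp) mulr_suml.
  rewrite exchange_big/=; apply: ler_sum => f _.
  under [leRHS]eq_bigr do rewrite -mulrA.
  rewrite -mulr_sumr ler_wpM2l ?pmf_ge0//.
  apply: le_trans (weierstrass_prod _ _) _ => [j|]; first by rewrite mass_ge0 mass_le1.
  apply: ler_sum => j _; have [->|fm] := eqVneq (f j : nat) m; first by rewrite mul1r.
  rewrite IH ?subrr ?mul0r// ltn_neqAle fm/= -ltnS; exact: ltn_ord.
have := sum_pow_lt1 hp p1 (isT : 1 < m)%N.
have := mass_le1 m; nra.
Qed.

Lemma law_out (n m : nat) : (n < m)%N -> law n m = 0.
Proof.
move=> nm; apply/eqP; rewrite eq_le law_ge0 andbT.
have := law_sum_le1 n m.+1; rewrite big_ord_recr/=.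
rewrite -(big_mkord xpredT (law n)) (@big_cat_nat _ _ _ n.+1)//= big_mkord.
rewrite -/(mass n) mass1 -addrA gerDl => /(le_trans _); apply.
by rewrite lerDr sumr_ge0// => k _; exact: law_ge0.
Qed.

Definition moment (h : nat -> R) (n : nat) : R := \sum_(m < n.+1) law n m * h m.

Lemma moment_widen (h : nat -> R) (n N : nat) : (n < N)%N ->
  \sum_(m < N) law n m * h m = moment h n.
Proof.
move=> nN; rewrite /moment [RHS](big_ord_widen N (fun m => law n m * h m))//.
rewrite [RHS]big_mkcond; apply: eq_bigr => m _; case: ltnP => // nm.
by rewrite law_out ?mul0r.
Qed.

Lemma mass_widen (n N : nat) : (n < N)%N -> \sum_(m < N) law n m = 1.
Proof.
move=> /(moment_widen (fun=> 1)); rewrite /moment.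
under eq_bigr do rewrite mulr1.
by under [X in _ = X]eq_bigr do rewrite mulr1; rewrite -/(mass n) mass1.
Qed.

(** [law_rec_le] bounds the law from below by a family that also has total mass 1,
    so the two coincide. *)
Lemma law_rec (n m : nat) : (1 < n)%N -> (m <= n)%N -> law n m = step_law n m.
Proof.
move=> n1 mn; have le k : 0 <= law n k - step_law n k.
  by rewrite subr_ge0 law_rec_le.
have sB : \sum_(k < n.+1) (law n k - step_law n k) <= 0.
  rewrite sumrB subr_le0 -/(mass n) mass1.
  apply: le_trans (mass_rec_le n1).
  rewrite -[leLHS](pmf_sum1 hp n d0) le_eqVlt; apply/orP; left; apply/eqP.
  by apply: eq_bigr => f _; rewrite big1 ?mulr1// => j _; exact: mass1.
have {}sB : \sum_(k < n.+1) (law n k - step_law n k) = 0.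
  by apply/eqP; rewrite eq_le sB/=; apply: sumr_ge0 => k _; exact: le.
apply/eqP; rewrite -subr_eq0; apply/eqP.
by apply: (psumr_eq0P _ sB (i := Ordinal (mn : (m < n.+1)%N))) => // k _; exact: le.
Qed.

Lemma moment_rec (h : nat -> R) (n : nat) : (1 < n)%N ->
  moment h n = \sum_(f : {ffun 'I_d -> 'I_n.+1})
    multinomial_pmf p n (fun j => f j) *
    \sum_(x : {ffun 'I_d -> 'I_n.+1}) \prod_j law (f j) (x j) *
      h (\sum_(j < d | (j < stop_slot n (fun j => f j))%N) x j)%N.
Proof.
move=> n1; rewrite /moment.
under eq_bigr => m _ do rewrite (law_rec n1 (ltn_ord m)) mulr_suml.
rewrite exchange_big/=; apply: eq_bigr => f _.
have [E|/(pmf_out p)->] := eqVneq (\sum_j f j)%N n; last first.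
  rewrite mul0r big1// => m _; rewrite big1 ?mul0r// => x _.
  by rewrite !mul0r.
under eq_bigr do rewrite mulr_suml.
rewrite exchange_big/= mulr_sumr; apply: eq_bigr => x _.
have [/forallP xf|] := boolP [forall j, (x j <= f j)%N]; last first.
  rewrite negb_forall => /existsP[j]; rewrite -ltnNge => xj.
  rewrite [X in _ = _ * (X * _)](bigD1 j)//= law_out// !mul0r mulr0 big1// => m _.
  by rewrite (bigD1 j)//= law_out// mul0r mulr0 !mul0r.
have xn : (\sum_(j < d | (j < stop_slot n (fun j => f j))%N) x j < n.+1)%N.
  rewrite ltnS -[leqRHS]E [leqLHS]big_mkcond/=.
  by apply: leq_sum => j _; case: ifP.
rewrite (bigD1 (Ordinal xn))//= eqxx mulr1 [X in _ + X]big1 ?addr0 ?mulrA// => m mx.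
case: eqP => [Em|_]; last by rewrite mulr0 mul0r.
by case/eqP: mx; apply: val_inj.
Qed.

(** Independence of the summands: a function of them that is a product over the
    slots has a product as its expectation; unread slots contribute their total
    mass 1. *)
Lemma pgf_rec (z : R) (n : nat) : (1 < n)%N ->
  moment (fun m => z ^+ m) n = \sum_(f : {ffun 'I_d -> 'I_n.+1})
    multinomial_pmf p n (fun j => f j) *
    \prod_(j < d | (j < stop_slot n (fun j => f j))%N) moment (fun m => z ^+ m) (f j).
Proof.
move=> n1; rewrite moment_rec//; apply: eq_bigr => f _; congr (_ * _).
rewrite [RHS]big_mkcond/=; set k := stop_slot _ _.
transitivity (\sum_(x : {ffun 'I_d -> 'I_n.+1})
    \prod_j (law (f j) (x j) * (if (j < k)%N then z ^+ x j else 1))).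
  apply: eq_bigr => x _; rewrite big_split/= -big_mkcond/=.
  by rewrite expr_sum.
rewrite (sum_slots f (fun j m => law (f j) m * if (j < k)%N then z ^+ m else 1)).
apply: eq_bigr => j _; case: ifP => _.
  by rewrite (@moment_widen (fun m => z ^+ m)).
by under eq_bigr do rewrite mulr1; rewrite mass_widen.
Qed.

Lemma mean_rec (n : nat) : (1 < n)%N ->
  moment (fun m => m%:R) n = \sum_(f : {ffun 'I_d -> 'I_n.+1})
    multinomial_pmf p n (fun j => f j) *
    \sum_(j < d | (j < stop_slot n (fun j => f j))%N) moment (fun m => m%:R) (f j).
Proof.
move=> n1; rewrite moment_rec//; apply: eq_bigr => f _; congr (_ * _).
under eq_bigr do rewrite natr_sum mulr_sumr.
rewrite exchange_big/=; apply: eq_bigr => i _.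
transitivity (\sum_(x : {ffun 'I_d -> 'I_n.+1})
    \prod_j (law (f j) (x j) * (if j == i then (x j)%:R else 1))).
  apply: eq_bigr => x _; rewrite big_split/=; congr (_ * _).
  by rewrite -big_mkcond/= big_pred1_eq.
rewrite (sum_slots f (fun j m => law (f j) m * if j == i then m%:R else 1)).
rewrite (bigD1 i)//= eqxx [X in _ * X]big1 ?mulr1 => [|j /negPf ji].
  exact: (moment_widen (fun m => m%:R) (ltn_ord (f i))).
by under eq_bigr do rewrite ji mulr1; rewrite mass_widen.
Qed.

Lemma moment0 h : moment h 0 = h 0%N.
Proof. by rewrite /moment big_ord1 law00 mul1r. Qed.

Lemma moment1 h : moment h 1 = h 1%N.
Proof.
have := mass1 1; rewrite /mass /moment !big_ord_recr !big_ord0/= !add0r law11.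
by move=> /eqP; rewrite -subr_eq0 addrK => /eqP->; rewrite mul0r add0r mul1r.
Qed.

Lemma pgf_le (z : R) (n : nat) :
  `|moment (fun m => z ^+ m) n| <= (Num.max 1 `|z|) ^+ n.
Proof.
have K1 : 1 <= Num.max 1 `|z| by rewrite le_max lexx.
have zK : `|z| <= Num.max 1 `|z| by rewrite le_max lexx orbT.
move: (Num.max 1 `|z|) K1 zK => K K1 zK.
apply: le_trans (ler_norm_sum _ _ _) _.
rewrite -[leRHS]mul1r -(mass1 n) /mass mulr_suml; apply: ler_sum => m _.
rewrite normrM ger0_norm ?law_ge0// ler_wpM2l ?law_ge0// normrX.
apply: le_trans (_ : K ^+ m <= _).
  by apply: lerXn2r; rewrite ?nnegrE ?normr_ge0 ?(le_trans ler01).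
by rewrite ler_weXn2l// -ltnS.
Qed.

Lemma expectation_successes (h : nat -> R) (n : nat) :
  P.-integrable setT (EFin \o (fun t => h (s n t))) /\
  'E_P[fun t => h (s n t)]%E = (moment h n)%:E.
Proof. by apply: finite_expectation; exact: mass1. Qed.

Lemma egf_termE (x z : R) :
  egf_term s x z = pgf_term (moment (fun m => z ^+ m)) x.
Proof.
apply/funext => n; rewrite /egf_term /pgf_term.
by have [_ ->] := expectation_successes (fun m => z ^+ m) n.
Qed.

End Successes.

(** * Degenerate splittings and conclusion *)

(** At x = 0 only the term n = 0 remains, so this holds for any splitting
    vector. *)
Lemma egf0 (R : realType) (dT : measure_display) (T : measurableType dT)
    (P : probability T R) (d : nat) (p : 'I_d -> R) (s : nat -> {RV P >-> nat})
    (z : R) : sicta_successes p s -> egf s 0 z = 1.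
Proof.
move=> [s0 _ _]; apply: cvg_lim => //.
have m0 : \sum_(m < 1) fine (P [set t | s 0%N t = m]) = 1.
  by rewrite big_ord1 s0.
have -> : egf_term s 0 z = fun n => if n == 0%N then 1 else 0.
  apply/funext => -[|n]; rewrite /egf_term; last by rewrite expr0n !mul0r.
  have [_ ->] := finite_expectation (fun m => z ^+ m) m0.
  by rewrite big_ord1 s0 /= !expr0 divr1 !mulr1.
exact: cvg_series_single.
Qed.

Lemma deterministic_split (R : realType) (d : nat) (p : 'I_d -> R) (j : 'I_d) :
  prob_vector p -> 1 <= p j -> forall i, p i = (i == j)%:R.
Proof.
move=> hp pj; have {}pj : p j = 1.
  by apply/eqP; rewrite eq_le pj; case/andP: (hp.1 j) => _ ->.
have /eqP := hp.2; rewrite (bigD1 j)//= pj -subr_eq0 addrAC subrr add0r => /eqP H i.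
case: eqVneq => [->//|ij].
by apply: (psumr_eq0P _ H) => // k _; case/andP: (hp.1 k).
Qed.

(** When all the packets fall into slot j, every factor S (x * p i) is S x or
    S 0 = 1, whatever the value of S x. *)
Lemma egf_deterministic (R : realType) (d : nat) (d0 : (0 < d)%N)
    (j : 'I_d) (S : R -> R) (x z : R) : S 0 = 1 ->
  let p i : R := (i == j)%:R in
  S x = (1 - p (Ordinal d0)) * x * (z - 1) + \prod_(i < d) S (x * p i) +
    \sum_(k < d | (1 <= k)%N)
      x * p k * (1 - z) * \prod_(i < d | (i < k)%N) S (x * p i).
Proof.
move=> S0 p; rewrite /p; have [j0|j0] := eqVneq j (Ordinal d0).
  rewrite mulr1n subrr !mul0r add0r [X in _ + X]big1 => [|k k0]; last first.
    by rewrite j0 -val_eqE/= gtn_eqF// mulr0 !mul0r.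
  rewrite addr0 (bigD1 j)//= eqxx mulr1 big1 ?mulr1// => i /negPf ->.
  by rewrite mulr0.
rewrite subr0 mul1r.
rewrite [X in _ + X + _](bigD1 j)//= eqxx mulr1.
rewrite [X in S x * X]big1 => [|i /negPf ->]; last by rewrite mulr0.
have jp : (1 <= j)%N by rewrite lt0n; move: j0; rewrite -val_eqE.
rewrite [X in _ + X](bigD1 j)//= eqxx mulr1.
rewrite [X in _ + (_ + X)]big1 => [|i /andP[_ /negPf ->]]; last first.
  by rewrite mulr0 !mul0r.
rewrite big1 => [|i ij]; first by rewrite mulr1n; ring.
by rewrite -val_eqE/= ltn_eqF// mulr0.
Qed.

Theorem mainTheorem7 (R : realType) (d : nat) (hd : (2 <= d)%N)
    (p : 'I_d -> R) (hp : prob_vector p)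
    (dT : measure_display) (T : measurableType dT) (P : probability T R)
    (s : nat -> {RV P >-> nat}) (hs : sicta_successes p s) :
  [/\ (forall j, p j < 1) -> forall n : nat,
        'E_P[fun t => (s n t)%:R]%E =
        (n%:R +
         \sum_(2 <= i < n.+1)
           'C(n, i)%:R *
           (((-1) ^+ (i - 1) * i%:R *
             (1 - \sum_(k < d) p k * Fbar p k ^+ (i - 1))) /
            (1 - \sum_(j < d) p j ^+ i)))%:E,
      (forall j, p j < 1) -> forall x z : R,
        (forall n : nat,
           P.-integrable setT (EFin \o (fun t => z ^+ s n t))) /\
        cvgn (series (egf_term s x z))
    & forall x z : R,
        egf s x z =
        (1 - p (Ordinal (ltnW hd))) * x * (z - 1)
        + \prod_(i < d) egf s (x * p i) z
        + \sum_(k < d | (1 <= k)%N)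
            x * p k * (1 - z) * \prod_(i < d | (i < k)%N) egf s (x * p i) z ].

Proof.
have d0 : (0 < d)%N := ltnW hd.
split=> [p1 n|p1 x z|x z].
- have [_ ->] := expectation_successes hp p1 d0 hs (fun m => m%:R) n.
  congr EFin; rewrite -success_meanE; apply: success_mean_unique => //.
  + by rewrite (moment0 hs).
  + by rewrite (moment1 hp p1 d0 hs).
  + by move=> m m1; exact: (mean_rec hp p1 d0 hs m1).
- split=> [n|]; first by case: (expectation_successes hp p1 d0 hs (fun m => z ^+ m) n).
  rewrite (egf_termE hp p1 d0 hs).
  exact: (normed_cvg (is_cvg_series_pgf_term (x := x) (pgf_le hp p1 d0 hs z))).
- have [p1|] := pselect (forall j, p j < 1).
    rewrite /egf; under [X in _ = _ + X + _]eq_bigr do rewrite (egf_termE hp p1 d0 hs).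
    under [X in _ = _ + X]eq_bigr => k _ do
      under eq_bigr do rewrite (egf_termE hp p1 d0 hs).
    rewrite (egf_termE hp p1 d0 hs).
    apply: (pgf_functional_equation hp (ltnW hd) _ _ (pgf_rec hp p1 d0 hs z)
      (pgf_le hp p1 d0 hs z) x).
    + by rewrite (moment0 hs).
    + by rewrite (moment1 hp p1 d0 hs).
  move=> /existsNP[j /negP]; rewrite -leNgt => pj.
  have pE := deterministic_split hp pj.
  have := @egf_deterministic R d (ltnW hd) j (fun y => egf s y z) x z (egf0 z hs).
  have -> : p = fun i => (i == j)%:R by exact/funext.
  exact.
Qed.
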